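(* Let $n\ge 1$ and let $D[1\ldots n]$ be an array storing a map $f:[n]\to[n]$ as the sequence $f(1),f(2),\ldots,f(n)$. If it is allowed to modify the elements of the array in the range $[-n,n]$, then there is an algorithm that rearranges $f$ in-place in (nondecreasing) order of its elements, unstably, in $\mathcal{O}(n)$ time using only $4\log n$ bits of additional space in total.
   Context: $[n]=\{1,2,\ldots,n\}$. Computation is on a unit-cost random access machine. ''In-place'' means that at termination the same array $D[1\ldots n]$ contains the result, here the sequence of the values $f(1),\ldots,f(n)$ arranged in nondecreasing order. During the computation entries of $D$ may be overwritten by integers in $\{-n,\ldots,n\}$. ''Using $c\log n$ bits'' means that, besides the array, the algorithm uses $c$ auxiliary variables of $\log n$ bits each (indices or values of magnitude $O(n)$). ''Unstably'' means that no claim is made about the relative order of equal elements. *)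

(* Defs.v *)
From mathcomp Require Import all_boot all_order all_algebra.

Set Implicit Arguments.
Unset Strict Implicit.
Unset Printing Implicit Defensive.

Import Order.TTheory GRing.Theory Num.Theory.
Local Open Scope ring_scope.

(* A unit-cost random access machine whose only writable storage is the array *)
(* D[1..n] and k auxiliary variables.  A program is a fixed list of           *)
(* instructions, not depending on n; the finite control is not charged as     *)
(* space.                                                                     *)

Inductive binop := AddOp | SubOp | MulOp | DivOp.

(* [Len] is the array length n, part of the (read-only) problem instance. *)
Inductive operand (k : nat) := Var of 'I_k | Const of int | Len.

Arguments Const {k}.
Arguments Len {k}.

Inductive instr (k : nat) :=
  | Op of 'I_k & binop & operand k & operand k   (* x := a op b *)
  | Read of 'I_k & operand k                     (* x := D[a] *)
  | Write of operand k & operand k               (* D[a] := b *)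
  | JumpLe of operand k & operand k & nat        (* if a <= b then goto l *)
  | Halt.

Arguments Read {k}.
Arguments Halt {k}.

Definition program (k : nat) := seq (instr k).

Record config (k : nat) := Config {
  pc : nat;
  var : 'I_k -> int;
  arr : seq int  (* D[i] is stored at position i - 1, and n = size arr *)
}.

Section Semantics.
Variables (k : nat) (B : nat) (P : program k).
Implicit Types s : config k.

Definition value s (a : operand k) : int :=
  match a with
  | Var x => var s x
  | Const c => c
  | Len => (size (arr s))%:Z
  end.

Definition arith (o : binop) (x y : int) : option int :=
  match o with
  | AddOp => Some (x + y)
  | SubOp => Some (x - y)
  | MulOp => Some (x * y)
  | DivOp => if y == 0 then None else Some (x %/ y)%Z
  end.

Definition in_bounds s (i : int) : bool := 1 <= i <= (size (arr s))%:Z.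

(* Auxiliary variables hold values of magnitude at most B * n only, that is   *)
(* log n + O(1) bits each; a violation is a fault.                            *)
Definition set_var s (x : 'I_k) (v : int) : option (config k) :=
  if `|v| <= (B * size (arr s))%:Z
  then Some (Config (pc s).+1 (fun y => if y == x then v else var s y) (arr s))
  else None.

Definition set_arr s (i v : int) : option (config k) :=
  if in_bounds s i && (`|v| <= (size (arr s))%:Z)
  then Some (Config (pc s).+1 (var s) (set_nth 0 (arr s) (absz i).-1 v))
  else None.

Definition current s : option (instr k) := onth P (pc s).

(* [None] when the machine has halted or faults. *)
Definition step s : option (config k) :=
  if current s is Some c then
    match c with
    | Op x o a b => obind (set_var s x) (arith o (value s a) (value s b))
    | Read x a =>
        if in_bounds s (value s a)
        then set_var s x (nth 0 (arr s) (absz (value s a)).-1)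
        else None
    | Write a b => set_arr s (value s a) (value s b)
    | JumpLe a b l =>
        Some (Config (if value s a <= value s b then l else (pc s).+1)
                     (var s) (arr s))
    | Halt => None
    end
  else None.

Fixpoint run (t : nat) s : option (config k) :=
  if t is t'.+1 then obind (run t') (step s) else Some s.

Definition halted s : bool := if current s is Some Halt then true else false.

Definition start (D : seq int) : config k := Config 0 (fun=> 0) D.

(* Every configuration visited respects the bounds on the auxiliary variables *)
(* and on the array entries, since [step] faults otherwise.                   *)
Definition computes_within (T : nat) (D D' : seq int) : Prop :=
  exists t s, [/\ (t <= T)%N, run t (start D) = Some s, halted s & arr s = D'].

End Semantics.

(* [n] is represented by 'I_n, so the element i of 'I_n stands for i + 1. *)
Definition array_of (n : nat) (f : 'I_n -> 'I_n) : seq int :=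
  [seq ((f i).+1)%:Z | i <- enum 'I_n].

Definition sorting_of (D D' : seq int) : Prop :=
  perm_eq D' D /\ sorted <=%R D'.

(* Main.v *)
Require Import Defs.
From mathcomp Require Import all_boot all_order all_algebra.
From mathcomp Require Import zify.

(* The sort runs in four linear passes.                                       *)
(* 1. Histogram: a value v > 0 is picked up at D[i], leaving 0, and dropped   *)
(*    at D[v]; if D[v] <= 0 it is minus the number of copies of v dropped so  *)
(*    far and is decremented, otherwise the value found there is picked up    *)
(*    next and D[v] becomes -1.                                               *)
(* 2. Each nonzero -count(v) is replaced by the first position p(v) of v in   *)
(*    the sorted array, through running sums.                                 *)
(* 3. The partial injection v |-> p(v) is inverted by following its chains:   *)
(*    writing -v in D[p(v)] displaces p(p(v)), which is treated next.  A      *)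
(*    chain entered in the middle is completed when its beginning is met, as  *)
(*    0 was left at the entry point.                                          *)
(* 4. A left-to-right sweep fills each block from its negated first entry.    *)
(* In passes 1 and 3 every iteration either advances i or turns one positive  *)
(* integer, in the array or in hand, into a nonpositive one.                  *)

Set Implicit Arguments.
Unset Strict Implicit.
Unset Printing Implicit Defensive.

Import Order.TTheory GRing.Theory Num.Theory.
Local Open Scope ring_scope.

(** This is counting sort with all its tables inside the array. Keys and positions both range over
    [n], so cell v can serve value v, and the sign of an entry tells which of two meanings it has.

    While counting, a positive entry is an input copy not yet counted and a nonpositive one is a
    counter. The invariant [counting] is a conservation law: for each value u, the copies of u still
    in the array or in hand, together with the counter in cell u if there is one, amount to the
    multiplicity of u in the input. While inverting, a positive entry is a pointer not yet followed,
    a negative one is a final block marker, and 0 is a free cell. Distinct values have distinct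
    first positions ([first_inj]), so no marker overwrites another. The invariant [inverting] says
    that each occurring value is still pointed from its own cell, is in hand, or is already marked.

    Linear time for these two passes comes from the potential [pending], at most 2n at the start;
    the ranking and filling passes are plain sweeps. Correctness is stated against the sorted
    sequence [S]: running sums are first positions by [index_sorted], and a cell that does not begin
    a block repeats its left neighbour by [at_sorted_repeat]. The lemmas [counting_step],
    [ranking_step], [inverting_step] and [filling_step] execute one loop body symbolically,
    [reach_loop] iterates them, and [sort_array] joins the passes. *)

Definition state : Type := nat * seq int * seq int.

(** Registers are compared pointwise with a sequence, so equality of the functions [var] never has
    to be proved. *)
Definition agree k (s : config k) (st : state) : Prop :=
  [/\ pc s = st.1.1, forall x, var s x = nth 0 st.1.2 (val x) & arr s = st.2].

Definition reach k B (P : program k) (T : nat) (st st' : state) : Prop :=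
  forall s, agree s st ->
  exists t s', [/\ (t <= T)%N, run B P t s = Some s' & agree s' st'].

Definition eval k (vs A : seq int) (a : operand k) : int :=
  match a with
  | Var x => nth 0 vs (val x)
  | Const c => c
  | Len => (size A)%:Z
  end.

(** * One-based array access and update *)

Definition at_ (A : seq int) (i : int) : int := nth 0 A (absz i).-1.
Definition put (A : seq int) (i v : int) : seq int := set_nth 0 A (absz i).-1 v.

Lemma size_put A i v : 1 <= i <= (size A)%:Z -> size (put A i v) = size A.
Proof. by move=> hi; rewrite size_set_nth; lia. Qed.

Lemma at_put_eq A i v : at_ (put A i v) i = v.
Proof. by rewrite /at_ nth_set_nth /= eqxx. Qed.

Lemma at_put_neq A (i v j : int) : 1 <= i -> 1 <= j -> j != i ->
  at_ (put A i v) j = at_ A j.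
Proof.
move=> hi hj hij; rewrite /at_ nth_set_nth /=.
by have -> : ((absz j).-1 == (absz i).-1) = false by lia.
Qed.

Lemma count_put (a : pred int) A (i v : int) : 1 <= i <= (size A)%:Z ->
  (count a (put A i v) + a (at_ A i) = count a A + a v)%N.
Proof.
move=> hi; have hi' : ((absz i).-1 < size A)%N by lia.
rewrite count_set_nth_ltn // subnK //.
rewrite /at_; case: (boolP (a _)) => //= ha.
apply: leq_trans (leq_addr _ _).
by rewrite -has_count; apply/hasP; exists (nth 0 A (absz i).-1); rewrite ?mem_nth.
Qed.

Lemma count_mem_put (u : int) A (i v : int) : 1 <= i <= (size A)%:Z ->
  (count_mem u (put A i v) + (at_ A i == u) = count_mem u A + (v == u))%N.
Proof. exact: (count_put (pred1 u)). Qed.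

(** * Executions with a time bound, and symbolic execution of instructions *)

Lemma run_add k B (P : program k) t1 t2 s :
  run B P (t1 + t2) s = obind (run B P t2) (run B P t1 s).
Proof. by elim: t1 s => //= t1 IH s; case: (step B P s) => //=. Qed.

Section Reach.
Context (k B : nat) (P : program k).
Implicit Types (st : state) (vs A : seq int).

Lemma reach_refl T st : reach B P T st st.
Proof. by move=> s hs; exists 0%N, s. Qed.

Lemma reach_leq T T' st st' :
  (T <= T')%N -> reach B P T st st' -> reach B P T' st st'.
Proof.
move=> hT h s /h [t [s' [ht e hs']]].
by exists t, s'; split=> //; apply: leq_trans hT.
Qed.

Lemma reach_trans T1 T2 st1 st2 st3 :
  reach B P T1 st1 st2 -> reach B P T2 st2 st3 -> reach B P (T1 + T2) st1 st3.
Proof.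
move=> h12 h23 s /h12 [t1 [s1 [ht1 e1]]] /h23 [t2 [s2 [ht2 e2 hs2]]].
by exists (t1 + t2)%N, s2; rewrite run_add e1 leq_add.
Qed.

Lemma reach_step T st1 st2 st3 :
    (forall s, agree s st1 -> exists2 s', step B P s = Some s' & agree s' st2) ->
  reach B P T st2 st3 -> reach B P T.+1 st1 st3.
Proof.
move=> h12 h23 s /h12 [s1 e1] /h23 [t2 [s2 [ht2 e2 hs2]]].
by exists t2.+1, s2; rewrite /= e1.
Qed.

(** The invariant is indexed by the number [m] of iterations left, so a single induction yields both
    correctness at exit and the time bound. *)
Lemma reach_loop p K (I : nat -> seq int -> seq int -> Prop) :
    (forall m vs A, I m.+1 vs A -> exists vs' A',
       reach B P K (p, vs, A) (p, vs', A') /\ I m vs' A') ->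
  forall m vs A, I m vs A -> exists vs' A',
    reach B P (m * K) (p, vs, A) (p, vs', A') /\ I 0%N vs' A'.
Proof.
move=> hI; elim=> [|m IH] vs A h; first by exists vs, A; split=> //; apply: reach_refl.
have [vs1 [A1 [h1 /IH [vs2 [A2 [h2 ?]]]]]] := hI _ _ _ h.
by exists vs2, A2; split=> //; rewrite mulSn; apply: reach_trans h1 h2.
Qed.

Lemma eval_agree s p vs A (a : operand k) :
  agree s (p, vs, A) -> value s a = eval vs A a.
Proof. by case: a => [x|c|] [_ hv /= ha]; rewrite //= ha. Qed.

Lemma set_var_agree s p vs A (x : 'I_k) v :
    `|v| <= (B * size A)%:Z -> agree s (p, vs, A) ->
  exists2 s', set_var B s x v = Some s' & agree s' (p.+1, set_nth 0 vs (val x) v, A).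
Proof.
move=> hv [hp hvs hA]; rewrite /set_var hA hv; eexists; first by [].
by split=> /= [|y|//]; rewrite ?hp // nth_set_nth /= -val_eqE hvs.
Qed.

Lemma reach_op T p vs A x o (a b : operand k) v st :
    onth P p = Some (Op x o a b) ->
    arith o (eval vs A a) (eval vs A b) = Some v ->
    `|v| <= (B * size A)%:Z ->
  reach B P T (p.+1, set_nth 0 vs (val x) v, A) st ->
  reach B P T.+1 (p, vs, A) st.
Proof.
move=> hc ho hv; apply: reach_step => s hs.
rewrite /step /current; have [-> _ _] := hs; rewrite hc.
by rewrite !(eval_agree _ hs) ho; apply: set_var_agree.
Qed.

Lemma reach_read T p vs A x (a : operand k) st :
    onth P p = Some (Read x a) ->
    1 <= eval vs A a <= (size A)%:Z ->
    `|at_ A (eval vs A a)| <= (B * size A)%:Z ->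
  reach B P T (p.+1, set_nth 0 vs (val x) (at_ A (eval vs A a)), A) st ->
  reach B P T.+1 (p, vs, A) st.
Proof.
move=> hc hi hv; apply: reach_step => s hs.
rewrite /step /current /in_bounds; have [-> _ /= hA] := hs; rewrite hc.
by rewrite !(eval_agree _ hs) hA hi; apply: set_var_agree.
Qed.

Lemma reach_write T p vs A (a b : operand k) st :
    onth P p = Some (Write a b) ->
    1 <= eval vs A a <= (size A)%:Z ->
    `|eval vs A b| <= (size A)%:Z ->
  reach B P T (p.+1, vs, put A (eval vs A a) (eval vs A b)) st ->
  reach B P T.+1 (p, vs, A) st.
Proof.
move=> hc hi hv; apply: reach_step => s hs.
rewrite /step /current /set_arr /in_bounds; have [hp hvs /= hA] := hs.
rewrite hp hc !(eval_agree _ hs) hA hi hv; eexists; first by [].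
by split=> //=; rewrite hp.
Qed.

Lemma reach_jump T p vs A (a b : operand k) l st :
    onth P p = Some (JumpLe a b l) ->
    eval vs A a <= eval vs A b ->
  reach B P T (l, vs, A) st -> reach B P T.+1 (p, vs, A) st.
Proof.
move=> hc hle; apply: reach_step => s hs.
rewrite /step /current; have [hp hvs /= hA] := hs.
by rewrite hp hc !(eval_agree _ hs) hle; eexists; first by [].
Qed.

Lemma reach_skip T p vs A (a b : operand k) l st :
    onth P p = Some (JumpLe a b l) ->
    eval vs A b < eval vs A a ->
  reach B P T (p.+1, vs, A) st -> reach B P T.+1 (p, vs, A) st.
Proof.
move=> hc hle; apply: reach_step => s hs.
rewrite /step /current; have [hp hvs /= hA] := hs.
rewrite hp hc !(eval_agree _ hs) leNgt hle; eexists; first by [].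
by split=> //=; rewrite hp.
Qed.

End Reach.

(** * The sorting program *)

Notation ri := (@Ordinal 4 0 isT).
Notation rc := (@Ordinal 4 1 isT).
Notation rt := (@Ordinal 4 2 isT).
Notation rw := (@Ordinal 4 3 isT).
Notation "x <~ a" := (Op x AddOp a (Const 0)) (at level 70).
Notation goto := (JumpLe (Const 0) (Const 0)).

(* The numbers on the right are instruction addresses, from 0.                *)
Definition sort_program : program 4 :=
  [:: ri <~ Const 1;                             (* 0 *)
      JumpLe (Const 1) (Var rt) 9;
      JumpLe (Var ri) Len 4;
      goto 17;
      Read rt (Var ri);
      JumpLe (Var rt) (Const 0) 7;
      Write (Var ri) (Const 0);
      Op ri AddOp (Var ri) (Const 1);
      goto 1;
      Read rw (Var rt);
      rc <~ Var rw;                              (* 10 *)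
      JumpLe (Var rw) (Const 0) 13;
      rc <~ Const 0;
      Op rc SubOp (Var rc) (Const 1);
      Write (Var rt) (Var rc);
      rt <~ Var rw;
      goto 1;
      ri <~ Const 1;                             (* 17 *)
      rc <~ Const 1;
      JumpLe (Var ri) Len 21;
      goto 27;                                   (* 20 *)
      Read rt (Var ri);
      JumpLe (Const 0) (Var rt) 25;
      Write (Var ri) (Var rc);
      Op rc SubOp (Var rc) (Var rt);
      Op ri AddOp (Var ri) (Const 1);
      goto 19;
      ri <~ Const 1;                             (* 27 *)
      rt <~ Const 0;
      JumpLe (Const 1) (Var rt) 38;
      JumpLe (Var ri) Len 32;                    (* 30 *)
      goto 43;
      Read rt (Var ri);
      JumpLe (Var rt) (Const 0) 36;
      Write (Var ri) (Const 0);
      Op rc SubOp (Const 0) (Var ri);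
      Op ri AddOp (Var ri) (Const 1);
      goto 29;
      Read rw (Var rt);
      Write (Var rt) (Var rc);
      Op rc SubOp (Const 0) (Var rt);            (* 40 *)
      rt <~ Var rw;
      goto 29;
      ri <~ Const 1;                             (* 43 *)
      JumpLe (Var ri) Len 46;
      Halt;
      Read rt (Var ri);
      JumpLe (Const 0) (Var rt) 49;
      Op rc SubOp (Const 0) (Var rt);
      Write (Var ri) (Var rc);
      Op ri AddOp (Var ri) (Const 1);            (* 50 *)
      goto 44
  ].

Notation sreach := (reach 2 sort_program).

Ltac side := rewrite /= ?size_put ?addr0 ?add0r; lia.
Ltac op := apply: reach_op; [by [] | by [] | side | rewrite /= ?addr0 ?add0r].
Ltac rd := apply: reach_read; [by [] | side | side | rewrite /=].
Ltac wr := apply: reach_write; [by [] | side | side | rewrite /=].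
Ltac jp := apply: reach_jump; [by [] | side | rewrite /=].
Ltac sk := apply: reach_skip; [by [] | side | rewrite /=].

(** * Pass 1: the histogram *)

(* [i] is the next cell to visit and [t] the integer in hand, if positive.     *)
Record counting (D : seq int) (i t : int) (A : seq int) : Prop := Counting {
  counting_size : size A = size D;
  counting_i : 1 <= i <= (size D)%:Z + 1;
  counting_t : t <= (size D)%:Z;
  counting_bound : forall j : int, 1 <= j <= (size D)%:Z -> `|at_ A j| <= (size D)%:Z;
  counting_done : forall j : int, 1 <= j < i -> at_ A j <= 0;
  counting_neg : forall u : int, 1 <= u <= (size D)%:Z -> at_ A u <= 0 ->
    (count_mem u D)%:Z = (count_mem u A + (t == u))%:Z - at_ A u;
  counting_pos : forall u : int, 1 <= u <= (size D)%:Z -> 0 < at_ A u ->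
    (count_mem u D = count_mem u A + (t == u))%N }.

(** The potential shared by passes 1 and 3: cells not yet visited, plus positive integers in the
    array or in hand. Each iteration lowers it by exactly one. *)
Definition pending (i t : int) (A : seq int) : nat :=
  (absz ((size A)%:Z + 1 - i)%R + (count (fun x : int => (0 < x)%R) A + (0 < t)%R))%N.

Lemma counting_fetch D i t A : counting D i t A -> t <= 0 -> i <= (size D)%:Z ->
  at_ A i <= 0 -> counting D (i + 1) (at_ A i) A.
Proof.
case=> hs hi ht hb hd hn hp t0 iD a0; split => //; try lia.
- by move=> j hj; case: (eqVneq j i) => [->//|?]; apply: hd; lia.
- by move=> u hu au; rewrite (hn u) //; lia.
- by move=> u hu au; rewrite (hp u) //; lia.
Qed.

Lemma counting_pick D i t A : counting D i t A -> t <= 0 -> i <= (size D)%:Z ->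
  0 < at_ A i -> counting D (i + 1) (at_ A i) (put A i 0).
Proof.
case=> hs hi ht hb hd hn hp t0 iD a0.
have iA : 1 <= i <= (size A)%:Z by lia.
have hc u := count_mem_put u 0 iA.
split => [|||j hj|j hj|u hu|u hu]; first by rewrite size_put.
- by lia.
- by have := hb i; lia.
- have [->|ne] := eqVneq j i; first by rewrite at_put_eq; lia.
  by rewrite at_put_neq; try lia; exact: hb.
- have [->|ne] := eqVneq j i; first by rewrite at_put_eq.
  by rewrite at_put_neq; try lia; apply: hd; lia.
- have := hc u; have [->|ne] := eqVneq u i.
    by rewrite at_put_eq (hp i) //; lia.
  by rewrite at_put_neq; try lia; move=> h au; rewrite (hn u) //; lia.
- have := hc u; have [->|ne] := eqVneq u i; first by rewrite at_put_eq.
  by rewrite at_put_neq; try lia; move=> h au; rewrite (hp u) //; lia.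
Qed.

(** The minimum merges two cases: an existing counter is decremented, whereas a displaced copy
    leaves a new counter of value -1. *)
Lemma counting_insert D i t A : counting D i t A -> 0 < t ->
  let c := Num.min (at_ A t) 0 - 1 in
  `|c| <= (size D)%:Z /\ counting D i (at_ A t) (put A t c).
Proof.
case=> hs hi ht hb hd hn hp t0.
have tA : 1 <= t <= (size A)%:Z by lia.
have c0 : `|Num.min (at_ A t) 0 - 1| <= (size D)%:Z.
  have := hb t; have [a0 _|a0 _] := leP (at_ A t) 0; last by lia.
  (* By the conservation law, the copy in hand and those already counted number at most the copies
     of [t] in [D], so the decremented counter stays in range. *)
  have : (count_mem t D <= size D)%N by exact: count_size.
  by have := hn t; lia.
set c := Num.min _ _ - 1 in c0 *; split=> //.
have cE : (at_ A t <= 0) /\ c = at_ A t - 1 \/ (0 < at_ A t) /\ c = -1.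
  by rewrite /c; case: leP; lia.
clearbody c; have hc u := count_mem_put u c tA.
split => [|||j hj|j hj|u hu|u hu]; first by rewrite size_put.
- by lia.
- by have := hb t; lia.
- have [->|ne] := eqVneq j t; first by rewrite at_put_eq; lia.
  by rewrite at_put_neq; try lia; exact: hb.
- have [->|ne] := eqVneq j t; first by rewrite at_put_eq; lia.
  by rewrite at_put_neq; try lia; apply: hd; lia.
- have := hc u; have [->|ne] := eqVneq u t.
    by rewrite at_put_eq; have := hn t; have := hp t; lia.
  by rewrite at_put_neq; try lia; move=> h au; rewrite (hn u) //; lia.
- have := hc u; have [->|ne] := eqVneq u t; first by rewrite at_put_eq; lia.
  by rewrite at_put_neq; try lia; move=> h au; rewrite (hp u) //; lia.
Qed.

Lemma pending_fetch (i t : int) A : 1 <= i <= (size A)%:Z -> t <= 0 -> at_ A i <= 0 ->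
  pending i t A = (pending (i + 1) (at_ A i) A).+1.
Proof. by rewrite /pending; lia. Qed.

Lemma pending_pick (i t : int) A : 1 <= i <= (size A)%:Z -> t <= 0 -> 0 < at_ A i ->
  pending i t A = (pending (i + 1) (at_ A i) (put A i 0)).+1.
Proof.
move=> hi t0 a0; have := count_put (fun x : int => 0 < x) 0 hi.
by rewrite /pending size_put //=; lia.
Qed.

Lemma pending_process (i t : int) A c : 1 <= t <= (size A)%:Z -> c <= 0 ->
  pending i t A = (pending i (at_ A t) (put A t c)).+1.
Proof.
move=> ht c0; have := count_put (fun x : int => 0 < x) c ht.
by rewrite /pending size_put //=; lia.
Qed.

(** This keeps the read of cell [i] in bounds: past the end, every entry would be nonpositive and
    the potential would vanish. *)
Lemma pending_gt0 (i t : int) A m : i <= (size A)%:Z + 1 ->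
    (forall j : int, 1 <= j < i -> at_ A j <= 0) -> t <= 0 ->
  pending i t A = m.+1 -> i <= (size A)%:Z.
Proof.
move=> hi hA t0; rewrite leNgt /pending => hm; apply/negP => iA.
have /eqP : count (fun x : int => 0 < x) A == 0%N; last by lia.
rewrite -leqn0 leqNgt -has_count -all_predC; apply/(all_nthP 0) => j jA /=.
have {}jA : (j < size A)%N := jA.
by rewrite -leNgt; apply: (hA j.+1); lia.
Qed.

Lemma pending0 (i t : int) A : 1 <= i <= (size A)%:Z + 1 -> pending i t A = 0%N ->
  [/\ i = (size A)%:Z + 1, t <= 0 & forall j, at_ A j <= 0].
Proof.
move=> hi; rewrite /pending => h; split; try by lia.
move=> j; have : ~~ has (fun x : int => 0 < x) A by rewrite has_count; lia.
rewrite leNgt; apply: contra => aj; apply/hasP; exists (at_ A j) => //.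
(* An access outside the array returns the default 0, which is not positive, so [j] needs no range
   condition. *)
by rewrite mem_nth //; move: aj; rewrite /at_; case: leqP => // ?; rewrite nth_default.
Qed.


Definition counting_at D m vs A : Prop := exists i c t w,
  [/\ vs = [:: i; c; t; w], counting D i t A & pending i t A = m].

(** The constant 9 is the longest path through the loop body, taken when dropping [t] displaces
    another positive integer. *)
Lemma counting_step D m vs A : counting_at D m.+1 vs A ->
  exists vs' A', sreach 9 (1%N, vs, A) (1%N, vs', A') /\ counting_at D m vs' A'.
Proof.
case=> i [c [t [w [-> h hm]]]]; have [hs hi ht hb hd _ _] := h.
have [t0|t0] := ltP 0 t.
- have tA : 1 <= t <= (size A)%:Z by lia.
  have hat := hb t.
  have [] := counting_insert h t0; have [w0|w0] := leP (at_ A t) 0 => c0 h'.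
    exists [:: i; at_ A t - 1; at_ A t; at_ A t], (put A t (at_ A t - 1)); split.
      by jp; rd; op; jp; op; wr; op; jp; apply: reach_refl.
    do 4 eexists; split; [by []|exact: h'|].
    by apply: succn_inj; rewrite -hm (pending_process i tA (c := at_ A t - 1)) //; lia.
  exists [:: i; -1; at_ A t; at_ A t], (put A t (-1)); split.
    by jp; rd; op; sk; op; op; wr; op; jp; apply: reach_refl.
  do 4 eexists; split; [by []|exact: h'|].
  by apply: succn_inj; rewrite -hm (pending_process i tA (c := -1)).
- have iD : i <= (size D)%:Z.
    by rewrite -hs; apply: pending_gt0 hm => //; lia.
  have iA : 1 <= i <= (size A)%:Z by lia.
  have hai := hb i.
  have [a0|a0] := leP (at_ A i) 0.
    exists [:: i + 1; c; at_ A i; w], A; split.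
      by sk; jp; rd; jp; op; jp; apply: reach_refl.
    do 4 eexists; split; [by []|exact: (counting_fetch h)|].
    by apply: succn_inj; rewrite -hm (pending_fetch iA t0 a0).
  exists [:: i + 1; c; at_ A i; w], (put A i 0); split.
    by sk; jp; rd; sk; wr; op; jp; apply: reach_refl.
  do 4 eexists; split; [by []|exact: (counting_pick h)|].
  by apply: succn_inj; rewrite -hm (pending_pick iA t0 a0).
Qed.

Lemma at_mem (A : seq int) (j : int) : 1 <= j <= (size A)%:Z -> at_ A j \in A.
Proof. move=> hj; have h : ((absz j).-1 < size A)%N by lia.
by rewrite /at_ mem_nth. Qed.

Lemma histogram (D : seq int) : (0 < size D)%N -> {in D, forall x : int, 1 <= x <= (size D)%:Z} ->
  exists i c t w A, [/\
    sreach (19 * size D).+1 (0%N, [:: 0; 0; 0; 0], D) (1%N, [:: i; c; t; w], A),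
    i = (size D)%:Z + 1, t <= 0, size A = size D &
    forall j : int, 1 <= j <= (size D)%:Z -> at_ A j = - (count_mem j D)%:Z].
Proof.
move=> D0 hD.
have hDj (j : int) : 1 <= j <= (size D)%:Z -> 1 <= at_ D j <= (size D)%:Z.
  by move=> hj; apply/hD/at_mem.
have h0 : counting_at D (pending 1 0 D) [:: 1; 0; 0; 0] D.
  exists 1, 0, 0, 0; split=> //; split=> [|||j hj|j hj|u hu|u hu _]; try lia.
  - by have := hDj _ hj; lia.
  - by have := hDj _ hu; lia.
have [vs [A [h [i [c [t [w' [evs hA /pending0 hp]]]]]]]] :=
  reach_loop (@counting_step D) h0.
subst vs; have [hs hi _ _ _ hn _] := hA.
have {}hp : [/\ i = (size D)%:Z + 1, t <= 0 & forall j : int, at_ A j <= 0].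
  by rewrite -hs; apply: hp; lia.
have [ei t0 a0] := hp.
exists i, c, t, w', A; split=> // [|j hj].
  op; apply: reach_leq h.
  have := count_size (fun x : int => 0 < x) D; rewrite /pending; lia.
(* With the potential exhausted no copy of [j] is in the array or in hand, so conservation makes the
   counter complete. *)
have /eqP : count_mem j A == 0%N; last by have := hn _ hj (a0 j); lia.
rewrite -leqn0 leqNgt -has_count -all_predC; apply/(all_nthP 0) => l lA /=.
by have := a0 l.+1; rewrite /at_ /=; lia.
Qed.

(** * First positions in a sorted sequence *)

(* 1-based, and 0 when u does not occur.                                      *)
Definition first (S : seq int) (u : int) : int :=
  if u \in S then (index u S).+1%:Z else 0.

Lemma first_le (S : seq int) (u : int) : 0 <= first S u <= (size S)%:Z.
Proof.
rewrite /first; case: ifP => // uS.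
have : (index u S < size S)%N by rewrite index_mem.
by lia.
Qed.

Lemma first_gt0 (S : seq int) (u : int) : (0 < first S u) = (u \in S).
Proof. by rewrite /first; case: ifP. Qed.

Lemma at_first (S : seq int) (u : int) : 0 < first S u -> at_ S (first S u) = u.
Proof. by rewrite /first; case: ifP => // uS _; rewrite /at_ /= nth_index. Qed.

Lemma first_inj (S : seq int) (u v : int) : 0 < first S u -> first S u = first S v -> u = v.
Proof. by move=> hu e; rewrite -(at_first hu) e at_first // -e. Qed.

(** The entries before the first copy of [u] are exactly the smaller ones; this is what makes the
    running sums of pass 2 first positions. *)
Lemma index_sorted (S : seq int) (u : int) : sorted <=%R S -> u \in S ->
  index u S = count (fun x : int => x < u) S.
Proof.
elim: S => // x S IH; rewrite /= path_sortedE; last exact: le_trans.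
case/andP => /allP hx hS; rewrite inE eq_sym; case: eqVneq => [<- _|ne /= uS].
  rewrite ltxx; apply/esym/eqP; rewrite -leqn0 leqNgt -has_count -all_predC.
  by apply/allP => y /hx; rewrite /= -leNgt.
by rewrite (IH hS uS) lt_neqAle ne hx.
Qed.

Lemma count_lt_succ (S : seq int) (i : int) :
  count (fun x : int => x < i + 1) S = (count (fun x : int => (x < i)%R) S + count_mem i S)%N.
Proof.
elim: S => //= x S ->.
lia.
Qed.

(** The entry at [i - 1] lies between the first copy of the value and the copy at [i], hence equals
    both by sortedness. *)
Lemma at_sorted_repeat (S : seq int) (i : int) : sorted <=%R S -> 1 <= i <= (size S)%:Z ->
  first S (at_ S i) != i -> 2 <= i /\ at_ S (i - 1) = at_ S i.
Proof.
move=> hS hi; have hm := at_mem hi; rewrite /first hm => ne.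
have iS : ((absz i).-1 < size S)%N by lia.
have := index_nth 0 iS; have := nth_index 0 hm; rewrite -/(at_ S i).
move: (index _ _) ne => q ne eq_q le_q; have {ne le_q} lt_q : (q < (absz i).-1)%N by lia.
split; first by lia.
have le_nth (a b : nat) : (a <= b)%N -> (b < size S)%N -> nth 0 S a <= nth 0 S b.
  move=> ab bS; apply: (sorted_leq_nth le_trans le_refl 0 hS) => //.
  by rewrite inE (leq_ltn_trans ab).
apply/le_anti/andP; split; first by apply: le_nth; lia.
by rewrite -{1}eq_q; apply: le_nth; lia.
Qed.

(** * Pass 2: from multiplicities to first positions *)

Definition ranking_at (S : seq int) (m : nat) (vs A : seq int) : Prop :=
  exists i c t w, vs = [:: i; c; t; w] /\ [/\ size A = size S,
    1 <= i, i + m%:Z = (size S)%:Z + 1,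
    c = (count (fun x : int => (x < i)%R) S)%:Z + 1 &
    forall j : int, 1 <= j <= (size S)%:Z ->
      at_ A j = if j < i then first S j else - (count_mem j S)%:Z].

Lemma ranking_step (S : seq int) m vs A : sorted <=%R S -> ranking_at S m.+1 vs A ->
  exists vs' A', sreach 7 (19%N, vs, A) (19%N, vs', A') /\ ranking_at S m vs' A'.
Proof.
move=> hS [i [c [t [w [-> [hs hi hm hc hA]]]]]].
have iA : 1 <= i <= (size A)%:Z by lia.
have iS : 1 <= i <= (size S)%:Z by lia.
have ai := hA _ iS; rewrite ltxx in ai.
have hcnt := count_lt_succ S i.
(* The updated sum [c] is thus at most n + 1, within the register bound 2n. *)
have hle : (count (fun x : int => (x < i + 1)%R) S <= size S)%N by exact: count_size.
have [a0|a0] := leP 0 (at_ A i).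
  (* A zero counter can stay in place, since [first] is also 0 on absent values. *)
  have iNS : i \notin S by apply/count_memPn; lia.
  exists [:: i + 1; c; at_ A i; w], A; split.
    by jp; rd; jp; op; jp; apply: reach_refl.
  exists (i + 1), c, (at_ A i), w; split=> //; split=> // [|||j hj]; try lia.
  rewrite hA //; have [->|ne] := eqVneq j i; last by congr (if _ then _ else _); lia.
  rewrite ltxx ifT; last by lia.
  by rewrite /first (negPf iNS); lia.
have iinS : i \in S by rewrite -has_pred1 has_count; lia.
exists [:: i + 1; c - at_ A i; at_ A i; w], (put A i c); split.
  by jp; rd; sk; wr; op; op; jp; apply: reach_refl.
exists (i + 1), (c - at_ A i), (at_ A i), w; split=> //; split.
- by rewrite size_put.
- by lia.
- by lia.
- by lia.
move=> j hj; have [->|ne] := eqVneq j i.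
  by rewrite at_put_eq ifT; [rewrite /first iinS index_sorted //; lia | lia].
rewrite at_put_neq ?hA //; try lia.
by congr (if _ then _ else _); lia.
Qed.

(** * Pass 3: inverting the partial injection *)

(* The variable c holds minus the index whose image t is in hand.             *)
Record inverting (S : seq int) (i c t : int) (A : seq int) : Prop := Inverting {
  inverting_size : size A = size S;
  inverting_i : 1 <= i <= (size S)%:Z + 1;
  inverting_done : forall j : int, 1 <= j < i -> at_ A j <= 0;
  inverting_pos : forall j : int, 1 <= j <= (size S)%:Z -> 0 < at_ A j ->
    at_ A j = first S j /\ 0 <= at_ A (first S j);
  inverting_held : 0 < t ->
    [/\ 1 <= - c <= (size S)%:Z, t = first S (- c), at_ A (- c) <= 0 & 0 <= at_ A t];
  inverting_neg : forall j : int, 1 <= j <= (size S)%:Z -> at_ A j < 0 ->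
    first S (- at_ A j) = j;
  inverting_all : forall u : int, 1 <= u <= (size S)%:Z -> 0 < first S u ->
    [\/ at_ A u = first S u, 0 < t /\ c = - u | at_ A (first S u) = - u] }.

Lemma inverting_fetch (S : seq int) (i c t : int) A : inverting S i c t A -> t <= 0 ->
  i <= (size S)%:Z -> at_ A i <= 0 -> inverting S (i + 1) c (at_ A i) A.
Proof.
case=> hs hi hd hp hh hn ha t0 iS a0; split=> //; try lia.
- by move=> j hj; have [->//|ne] := eqVneq j i; apply: hd; lia.
by move=> u hu pu; case: (ha u hu pu) => [h|[t1 _]|h]; [exact: Or31|lia|exact: Or33].
Qed.

Lemma inverting_pick (S : seq int) (i c t : int) A : inverting S i c t A -> t <= 0 ->
  i <= (size S)%:Z -> 0 < at_ A i -> inverting S (i + 1) (- i) (at_ A i) (put A i 0).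
Proof.
case=> hs hi hd hp hh hn ha t0 iS a0.
have iA : 1 <= i <= (size S)%:Z by lia.
(* Writing 0 keeps every free target free, including cell [i] itself when [i] is a fixed point. *)
have ge0_put (j : int) : 1 <= j -> 0 <= at_ A j -> 0 <= at_ (put A i 0) j.
  move=> hj; have [->|ne] := eqVneq j i; first by rewrite at_put_eq.
  by rewrite at_put_neq //; lia.
split=> [||j hj|j hj|_|j hj|u hu pu].
- by rewrite size_put //; lia.
- by lia.
- have [->|ne] := eqVneq j i; first by rewrite at_put_eq.
  by rewrite at_put_neq; try lia; apply: hd; lia.
- have [->|ne] := eqVneq j i; first by rewrite at_put_eq.
  rewrite at_put_neq; try lia; move=> aj; have [e h] := hp j hj aj.
  by split=> //; apply: ge0_put => //; lia.
- rewrite opprK at_put_eq; have [e h] := hp i iA a0.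
  by split=> //; rewrite e; apply: ge0_put => //; lia.
- have [->|ne] := eqVneq j i; first by rewrite at_put_eq.
  by rewrite at_put_neq; try lia; apply: hn.
case: (ha u hu pu) => [h|[t1 _]|h]; [|lia|]; last first.
- by apply: Or33; rewrite at_put_neq //; try lia; apply/eqP => e; rewrite e in h; lia.
- have [->|ne] := eqVneq u i; first by apply: Or32.
  by apply: Or31; rewrite at_put_neq //; lia.
Qed.

(** By injectivity only [- c] has image [t], so the marker written there occupies no other value's
    target. The displaced entry, if positive, is the image of [t] and continues the chain. *)
Lemma inverting_chain (S : seq int) (i c t : int) A : inverting S i c t A -> 0 < t ->
  inverting S i (- t) (at_ A t) (put A t c).
Proof.
case=> hs hi hd hp hh hn ha t0.
have [hc et ac0 at0] := hh t0; have htS := first_le S (- c).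
have tA : 1 <= t <= (size S)%:Z by lia.
have inj (u : int) : first S u = t -> u = - c.
  by move=> e; apply: (@first_inj S); rewrite e.
split=> [||j hj|j hj|at_pos|j hj|u hu pu].
- by rewrite size_put //; lia.
- by lia.
- have [->|ne] := eqVneq j t; first by rewrite at_put_eq; lia.
  by rewrite at_put_neq; try lia; apply: hd; lia.
- have [->|ne] := eqVneq j t; first by rewrite at_put_eq; lia.
  rewrite at_put_neq; try lia; move=> aj; have [e h] := hp j hj aj.
  split=> //; rewrite at_put_neq //; try lia.
  by apply/eqP => /inj ej; rewrite ej in aj; lia.
- have [e h] := hp t tA at_pos; rewrite opprK at_put_eq; split=> //; first by lia.
  rewrite at_put_neq; try lia; first by rewrite e.
  (* If [t] were its own image, it would be [- c], whose cell is already nonpositive. *)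
  by apply/eqP; rewrite e => /inj ej; rewrite -ej in ac0; lia.
- have [->|ne] := eqVneq j t; first by rewrite at_put_eq.
  by rewrite at_put_neq; try lia; apply: hn.
have [ptu|ptu] := eqVneq (first S u) t.
  by apply: Or33; rewrite ptu at_put_eq; have := inj _ ptu; lia.
case: (ha u hu pu) => [h|[_ h]|h].
- have [eu|ne] := eqVneq u t; first by apply: Or32; split; [rewrite -eu h|rewrite eu].
  by apply: Or31; rewrite at_put_neq //; lia.
- by move: ptu; rewrite et h opprK eqxx.
by apply: Or33; rewrite at_put_neq //; lia.
Qed.

Definition inverting_at S m vs A : Prop := exists i c t w,
  [/\ vs = [:: i; c; t; w], inverting S i c t A & pending i t A = m].

(** Positive entries are positions and negative ones are negated values of [S], so both lie in
    range. *)
Lemma inverting_bound (S : seq int) (i c t : int) A :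
  {in S, forall x : int, 1 <= x <= (size S)%:Z} -> inverting S i c t A ->
  forall j : int, 1 <= j <= (size S)%:Z -> `|at_ A j| <= (size S)%:Z.
Proof.
move=> hSn [hs hi hd hp hh hn ha] j hj.
have [a0|a0|->] := ltgtP (at_ A j) 0; last by lia.
  have e := hn j hj a0.
  have : - at_ A j \in S by rewrite -first_gt0 e; lia.
  by move/hSn; lia.
by have [e _] := hp j hj a0; have := first_le S j; lia.
Qed.

Lemma inverting_step (S : seq int) m vs A :
    {in S, forall x : int, 1 <= x <= (size S)%:Z} -> inverting_at S m.+1 vs A ->
  exists vs' A', sreach 8 (29%N, vs, A) (29%N, vs', A') /\ inverting_at S m vs' A'.
Proof.
move=> hSn [i [c [t [w [-> h hm]]]]]; have [hs hi hd _ hh _ _] := h.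
have hb := inverting_bound hSn h.
have [t0|t0] := ltP 0 t.
- have [hc et _ _] := hh t0; have htS := first_le S (- c).
  have tA : 1 <= t <= (size A)%:Z by lia.
  have hat := hb t.
  exists [:: i; - t; at_ A t; at_ A t], (put A t c); split.
    by jp; rd; wr; op; op; jp; apply: reach_refl.
  do 4 eexists; split; [by []|exact: (inverting_chain h)|].
  by apply: succn_inj; rewrite -hm (pending_process i tA (c := c)) //; lia.
have iS : i <= (size S)%:Z by rewrite -hs; apply: pending_gt0 hm => //; lia.
have iA : 1 <= i <= (size A)%:Z by lia.
have hai := hb i.
have [a0|a0] := leP (at_ A i) 0.
  exists [:: i + 1; c; at_ A i; w], A; split.
    by sk; jp; rd; jp; op; jp; apply: reach_refl.
  do 4 eexists; split; [by []|exact: (inverting_fetch h)|].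
  by apply: succn_inj; rewrite -hm (pending_fetch iA t0 a0).
exists [:: i + 1; - i; at_ A i; w], (put A i 0); split.
  by sk; jp; rd; sk; wr; op; op; jp; apply: reach_refl.
do 4 eexists; split; [by []|exact: (inverting_pick h)|].
by apply: succn_inj; rewrite -hm (pending_pick iA t0 a0).
Qed.

(** * Pass 4: filling the blocks *)

(** The variable [c] is constrained only from [i = 2] on, because cell 1 always begins a block and
    sets it. *)
Definition filling_at (S : seq int) (m : nat) (vs A : seq int) : Prop :=
  exists i c t w, vs = [:: i; c; t; w] /\ [/\ size A = size S,
    1 <= i, i + m%:Z = (size S)%:Z + 1,
    2 <= i -> c = at_ S (i - 1) &
    forall j : int, 1 <= j <= (size S)%:Z ->
      at_ A j = if j < i then at_ S j
                else if first S (at_ S j) == j then - at_ S j else 0].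

Lemma filling_step (S : seq int) m vs A : sorted <=%R S ->
    {in S, forall x : int, 1 <= x <= (size S)%:Z} -> filling_at S m.+1 vs A ->
  exists vs' A', sreach 7 (44%N, vs, A) (44%N, vs', A') /\ filling_at S m vs' A'.
Proof.
move=> hS hSn [i [c [t [w [-> [hs hi hm hc hA]]]]]].
have iA : 1 <= i <= (size A)%:Z by lia.
have iS : 1 <= i <= (size S)%:Z by lia.
have si := hSn _ (at_mem iS).
have post (c' : int) : c' = at_ S i -> forall j : int, 1 <= j <= (size S)%:Z ->
    at_ (put A i c') j = if j < i + 1 then at_ S j
                else if first S (at_ S j) == j then - at_ S j else 0.
  move=> -> j hj; have [->|ne] := eqVneq j i.
    by rewrite at_put_eq ifT //; lia.
  by rewrite at_put_neq ?hA //; try lia; congr (if _ then _ else _); lia.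
have ai := hA _ iS; rewrite ltxx in ai.
case: eqP ai => [_|/eqP nf] ai.
  exists [:: i + 1; at_ S i; at_ A i; w], (put A i (at_ S i)); split.
    by jp; rd; sk; op; rewrite ai opprK; wr; op; jp; apply: reach_refl.
  exists (i + 1), (at_ S i), (at_ A i), w; split=> //; split.
  - by rewrite size_put.
  - by lia.
  - by lia.
  - by rewrite addrK.
  - exact: post.
have [i2 rep] := at_sorted_repeat hS iS nf.
have ec : c = at_ S i by rewrite -rep; apply: hc.
exists [:: i + 1; c; at_ A i; w], (put A i c); split.
  by jp; rd; jp; wr; op; jp; apply: reach_refl.
exists (i + 1), c, (at_ A i), w; split=> //; split.
- by rewrite size_put.
- by lia.
- by lia.
- by rewrite addrK.
- exact: post.
Qed.

(** * Joining the passes *)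

Lemma sort_array (D : seq int) : (0 < size D)%N ->
    {in D, forall x : int, 1 <= x <= (size D)%:Z} ->
  exists vs, sreach (100 * size D) (0%N, [:: 0; 0; 0; 0], D) (45%N, vs, sort <=%R D).
Proof.
move=> D0 hD; have [i1 [c1 [t1 [w1 [A1 [r1 ei1 ht1 hs1 hA1]]]]]] := histogram D0 hD.
have [S eS] : exists S : seq int, S = sort <=%R D by exists (sort <=%R D).
rewrite -eS.
have sS : size S = size D by rewrite eS size_sort.
have hS : sorted <=%R S by rewrite eS; apply: sort_sorted; exact: le_total.
have cS (u : int) : count_mem u D = count_mem u S.
  by apply/permP; rewrite perm_sym eS perm_sort.
have hSn : {in S, forall x : int, 1 <= x <= (size S)%:Z}.
  by move=> x; rewrite sS eS mem_sort => /hD.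
move: r1 hA1; rewrite -sS in D0 ei1 hs1 * => r1 hA1.
have [vs2 [A2 [r2 [i2 [c2 [t2 [w2 [evs2 [hs2 hi2 hm2 hc2 hA2]]]]]]]]] :
    exists vs A, sreach (size S * 7) (19%N, [:: 1; 1; t1; w1], A1) (19%N, vs, A) /\
      ranking_at S 0 vs A.
  apply: (reach_loop (I := ranking_at S)) => [m vs A|]; first exact: ranking_step.
  exists 1, 1, t1, w1; split=> //; split=> // [||j hj]; first by lia.
    suff /eqP -> : count (fun x : int => (x < 1)%R) S == 0%N by [].
    rewrite -leqn0 leqNgt -has_count -all_predC; apply/allP => x /hSn /=; lia.
  by rewrite ifF ?hA1 ?cS //; lia.
subst vs2.
have ei2 : i2 = (size S)%:Z + 1 by lia.
have hA2' (j : int) : 1 <= j <= (size S)%:Z -> at_ A2 j = first S j.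
  by move=> hj; rewrite hA2 // ifT //; lia.
have inv0 : inverting S 1 c2 0 A2.
  split=> // [|j hj|j hj|j hj|u hu _]; try lia.
  - rewrite hA2' // => pj; split=> //; have h1 := first_le S j.
    by have h2 := first_le S (first S j); rewrite hA2'; lia.
  - by rewrite hA2' //; have := first_le S j; lia.
  - by apply: Or31; exact: hA2'.
have [vs3 [A3 [r3 [i3 [c3 [t3 [w3 [evs3 inv3 /pending0 hp3]]]]]]]] :
    exists vs A, sreach (pending 1 0 A2 * 8) (29%N, [:: 1; c2; 0; w2], A2) (29%N, vs, A) /\
      inverting_at S 0 vs A.
  apply: (reach_loop (I := inverting_at S)) => [m vs A|]; first exact: inverting_step.
  by exists 1, c2, 0, w2.
subst vs3; have [hs3 hi3 _ _ _ neg3 all3] := inv3.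
have [|ei3 t30 a30] := hp3; first by lia.
have [vs4 [A4 [r4 [i4 [c4 [t4 [w4 [evs4 [hs4 hi4 hm4 _ hA4]]]]]]]]] :
    exists vs A, sreach (size S * 7) (44%N, [:: 1; c3; t3; w3], A3) (44%N, vs, A) /\
      filling_at S 0 vs A.
  apply: (reach_loop (I := filling_at S)) => [m vs A|]; first exact: filling_step.
  exists 1, c3, t3, w3; split=> //; split=> // [|j hj]; first by lia.
  rewrite ifF; last by lia.
  have uS := at_mem hj; have hu := hSn _ uS; rewrite -first_gt0 in uS.
  (* No positive entry remains and nothing is in hand, so only the third alternative of
     [inverting_all] survives. *)
  have af : at_ A3 (first S (at_ S j)) = - at_ S j.
    by case: (all3 _ hu uS) => [h|[h _]|//]; [have := a30 (at_ S j)|]; lia.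
  case: eqP => [e|ne]; first by rewrite -{1}e.
  (* A negative entry would make [j] the first position of some value, necessarily that of
     [at_ S j]; hence the entry is 0. *)
  have := a30 j; rewrite le_eqVlt => /orP [/eqP //|neg].
  have e := neg3 j hj neg; case: ne; rewrite -{1}e at_first ?e //; lia.
subst vs4.
have <- : A4 = S.
  apply: (@eq_from_nth _ 0) => // l lA.
  have {}lA : (l < size S)%N by rewrite -hs4.
  have hl : 1 <= l.+1%:Z <= (size S)%:Z by lia.
  by have := hA4 _ hl; rewrite ifT; [exact|lia].
exists [:: i4; c4; t4; w4].
have size2 : (pending 1 0 A2 <= 2 * size S)%N.
  have : (count (fun x : int => (0 < x)%R) A2 <= size A2)%N by exact: count_size.
  by rewrite /pending; lia.
(* The summands 5, 4, 4 and 1 count the instructions between loops. The total is at most 49n + 15,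
   hence below 100n for n at least 1. *)
apply: (@reach_leq _ _ _ ((19 * size S).+1 + (5 + (size S * 7 + (4 +
  (pending 1 0 A2 * 8 + (4 + (size S * 7 + 1)))))))); first by lia.
apply: reach_trans r1 _; do 2 sk; jp; op; op.
apply: reach_trans r2 _; sk; jp; op; op.
apply: reach_trans r3 _; do 2 sk; jp; op.
by apply: reach_trans r4 _; sk; exact: reach_refl.
Qed.

Theorem theorem4p1 :
  exists (P : program 4) (B C : nat),
    forall (n : nat) (f : 'I_n -> 'I_n), (1 <= n)%N ->
      exists D' : seq int,
        computes_within B P (C * n)%N (array_of f) D' /\
        sorting_of (array_of f) D'.
Proof.
(* The factor 2 allows the value n + 1, reached by the index at the end of a sweep and by the
   running sum. *)
exists sort_program, 2%N, 100%N => n f n1; exists (sort <=%R (array_of f)).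
have sD : size (array_of f) = n by rewrite size_map size_enum_ord.
split; last by split; [rewrite perm_sort | exact: sort_sorted le_total _].
have [||vs r] := @sort_array (array_of f); rewrite ?sD //.
  by move=> _ /mapP [i _ ->]; have := ltn_ord (f i); lia.
have [|t [s [ht e [hp _ hs]]]] := r (start _ (array_of f)).
  by split=> // -[[|[|[|[|]]]]].
by exists t, s; split; rewrite -?sD //= /halted /current hp.
Qed.
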